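(* There is a universal constant $c_0>0$ such that the following holds. Let $W\ge R\ge1$ be the numbers of workers and of regular workers, let $\delta=1-\frac RW$ be the fraction of poisoned workers, under label poisoning attacks, and let $L>0$, $\xi\ge0$, $\sigma\ge 0$, $A\ge0$, $J\ge 1$, $T\ge 1$ be given. Consider any (possibly randomized) algorithm running for $T$ iterations and generating $x^t$ at iteration $t$, whose output is invariant with respect to the identities of the workers. Then there exist $R$ regular local functions $\{f_w:w\in\mathcal{R}\}$ and $W-R$ poisoned local functions $\{\tilde f_w:w\in\mathcal{W}\setminus\mathcal{R}\}$, each an average of $J$ sample costs $f_{w,j}$ or $\tilde f_{w,j}$ respectively, such that, with $f=\frac1R\sum_{w\in\mathcal{R}}f_w$: (i) $f$ is bounded below: $f(x)\ge f^*$ for all $x$, for some $f^*\in\mathbb{R}$; (ii) $\|\nabla f(x)-\nabla f(y)\|\le L\|x-y\|$ for all $x,y$; (iii) $\max_{w\in\mathcal{R}}\|\nabla f_w(x)-\nabla f(x)\|\le\xi$ for all $x$; (iv) for all $x$, $\mathbb{E}_{i_w}\|\nabla f_{w,i_w}(x)-\nabla f_w(x)\|^2\le\sigma^2$ for $w\in\mathcal{R}$ and $\mathbb{E}_{i_w}\|\nabla\tilde f_{w,i_w}(x)-\nabla\tilde f_w(x)\|^2\le\sigma^2$ for $w\in\mathcal{W}\setminus\mathcal{R}$, with $i_w$ uniform on $\{1,\dots,J\}$; (v) $\max_{w\in\mathcal{W}\setminus\mathcal{R}}\|\nabla\tilde f_w(x)-\nabla f(x)\|\le A$ for all $x$; and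 the iterates $\{x^t:t=1,\dots,T\}$ of the algorithm satisfy $$\frac1T\sum_{t=1}^T\mathbb{E}\|\nabla f(x^t)\|^2\ \ge\ c_0\,\delta^2\min\{A^2,\xi^2\},$$ where the expectation is over the algorithm's randomness.
   Context: $\mathcal{W}$ is the set of $W$ workers and $\mathcal{R}\subseteq\mathcal{W}$ the set of $R$ regular workers; workers in $\mathcal{W}\setminus\mathcal{R}$ are poisoned. Local costs are $f_w(x)=\frac1J\sum_{j=1}^Jf_{w,j}(x)$ for $w\in\mathcal{R}$ and $\tilde f_w(x)=\frac1J\sum_{j=1}^J\tilde f_{w,j}(x)$ for $w\in\mathcal{W}\setminus\mathcal{R}$, with differentiable sample costs on a Euclidean space $\mathbb{R}^D$. Label poisoning attacks: the local costs of poisoned workers have the same form as those of regular workers but an arbitrary fraction of the sample labels is poisoned; the poisoned workers otherwise follow the algorithmic protocol exactly. Identity-invariance: given any $W$ local costs of which $R$ are regular, the output of the algorithm (the law of its iterates) is invariant with respect to which of the local costs are regular and which are poisoned; that is, it depends only on the collection (multiset) of the $W$ local costs. *)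

(* Defs.v *)
From HB Require Import structures.
From mathcomp Require Import all_boot all_order all_algebra all_fingroup.
From mathcomp Require Import all_classical all_reals all_analysis.

Set Implicit Arguments.
Unset Strict Implicit.
Unset Printing Implicit Defensive.

Import Order.TTheory GRing.Theory Num.Theory.
Import numFieldNormedType.Exports.

Local Open Scope classical_set_scope.
Local Open Scope ring_scope.

(* R^D with its Borel sigma-algebra. *)
Notation borel_rV R D := (g_sigma_algebraType (@open 'rV[R]_D)).

(* The library norm on 'rV[R]_D is the sup norm, hence this definition. *)
Definition l2norm (R : realType) (D : nat) (v : 'rV[R]_D) : R :=
  Num.sqrt (\sum_(i < D) v ord0 i ^+ 2).

Definition grad (R : realType) (D : nat) (f : 'rV[R]_D -> R) (x : 'rV[R]_D) :
  'rV[R]_D := \row_(i < D) 'D_(delta_mx ord0 i) f x.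

Record sample_cost (R : realType) (D : nat) := SampleCost {
  sample_fun :> 'rV[R]_D -> R ;
  sample_differentiable : forall x, differentiable sample_fun x }.

(* A local cost is given together with its J sample costs, since a stochastic
   algorithm may query the samples individually. *)
Definition local_cost (R : realType) (D J : nat) := 'I_J -> sample_cost R D.

Definition local_fun (R : realType) (D J : nat) (c : local_cost R D J) :
  'rV[R]_D -> R := fun x => J%:R^-1 * \sum_(j < J) c j x.

(* The average of the local costs of the workers in [Reg]. *)
Definition regular_fun (R : realType) (D J W : nat) (Reg : {set 'I_W})
    (c : 'I_W -> local_cost R D J) : 'rV[R]_D -> R :=
  fun x => #|Reg|%:R^-1 * \sum_(w in Reg) local_fun (c w) x.

(* The variance of the gradient of a uniformly drawn sample cost. *)
Definition sample_variance (R : realType) (D J : nat) (c : local_cost R D J)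
    (x : 'rV[R]_D) : R :=
  J%:R^-1 *
    \sum_(j < J) l2norm (grad (c j) x - grad (local_fun c) x) ^+ 2.

(* A run of a randomized algorithm: [x Reg c] is the random trajectory
   (x^1, ..., x^T) produced when the W local costs are [c] and the regular
   workers are [Reg]; the probability P carries the internal randomness.  The
   0-based component [tnth _ t] is the iterate x^(t+1). *)
Definition algorithm (R : realType) (D J W T : nat) (d : measure_display)
    (Omega : measurableType d) (P : probability Omega R) :=
  {set 'I_W} -> ('I_W -> local_cost R D J) ->
    {RV P >-> T.-tuple (borel_rV R D)}.

(* The joint law of the iterates depends neither on which [nreg] workers are
   regular nor on how the local costs are assigned to the workers, i.e. only on
   the multiset of local costs.  Laws are compared on measurable sets only, a
   measure being in the library a function on all sets. *)
Definition identity_invariant (R : realType) (D J W T : nat)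
    (d : measure_display) (Omega : measurableType d) (P : probability Omega R)
    (nreg : nat) (x : algorithm D J W T P) : Prop :=
  forall (Reg Reg' : {set 'I_W}) (c : 'I_W -> local_cost R D J) (s : 'S_W),
    #|Reg| = nreg -> #|Reg'| = nreg ->
    forall B : set (T.-tuple (borel_rV R D)), measurable B ->
      distribution P (x Reg c) B =
      distribution P (x Reg' (fun w => c (s w))) B.

(* Main.v *)
(* Every local cost is [L / 2 * x_1 ^ 2 + b_w * x_1], with tilt [b_w] equal to
   [mu := min(A, xi)] on a set of [k := min(R, W - R)] workers and to [0]
   elsewhere; all gradients of the costs are then within [mu] of each other.
   Placing the [k] tilted workers outside or inside the regular ones yields two
   instances with the same multiset of costs, hence iterates with the same law,
   although the gradients of the regular objectives differ everywhere by
   [(k / R) * mu >= delta * mu].  As [u^2 + v^2 >= (u - v)^2 / 2], the mean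
   squared gradient is at least [(delta * mu)^2 / 4] on one of them. *)

Require Import Defs.
From HB Require Import structures.
From mathcomp Require Import all_boot all_order all_algebra all_fingroup.
From mathcomp Require Import all_classical all_reals all_analysis.
From mathcomp Require Import measurable_realfun ring lra.

Set Implicit Arguments.
Unset Strict Implicit.
Unset Printing Implicit Defensive.

Import Order.TTheory GRing.Theory Num.Theory.
Import numFieldNormedType.Exports.

Local Open Scope classical_set_scope.
Local Open Scope ring_scope.

(** * Tilted quadratics in the first coordinate: gradients, variance, measurability *)

Section Quad.
Variables (R : realType) (D : nat).
Implicit Types (x y : 'rV[R]_D.+1).

Definition quad (L b : R) x : R := L / 2 * x ord0 ord0 ^+ 2 + b * x ord0 ord0.

(** A coordinate is a continuous linear form, hence its own differential. *)
Lemma is_derive_coord x v (i : 'I_D.+1) :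
  is_derive x v (fun y : 'rV[R]_D.+1 => y ord0 i) (v ord0 i).
Proof.
have lin : linear (fun y : 'rV[R]_D.+1 => y ord0 i : R^o).
  by move=> a y z; rewrite !mxE.
pose linM := GRing.isLinear.Build _ _ _ _ _ lin.
pose f : {linear _ -> _} :=
  HB.pack (fun y : 'rV[R]_D.+1 => y ord0 i : R^o) linM.
apply: DeriveDef; first exact/diff_derivable/differentiable_coord.
rewrite deriveE; last exact: differentiable_coord.
by rewrite (@diff_lin _ _ _ f)//; exact: coord_continuous.
Qed.

Let quadE (L b : R) :
  quad L b = (L / 2) *: ((fun y : 'rV[R]_D.+1 => y ord0 ord0) ^+ 2) +
             b *: (fun y : 'rV[R]_D.+1 => y ord0 ord0).
Proof. by []. Qed.

Lemma differentiable_quad (L b : R) x : differentiable (quad L b) x.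
Proof.
have dc : differentiable (fun y : 'rV[R]_D.+1 => y ord0 ord0 : R) x.
  exact: differentiable_coord.
rewrite quadE; apply: differentiableD; apply: differentiableZ => //.
exact: differentiableX.
Qed.

Lemma grad_quad (L b : R) x :
  grad (quad L b) x = (L * x ord0 ord0 + b) *: delta_mx ord0 ord0.
Proof.
apply/rowP => i; rewrite !mxE eqxx/=.
have Hc := is_derive_coord x (delta_mx ord0 i) ord0.
have Hq := is_deriveD (is_deriveZ (L / 2) (is_deriveX 2 Hc)) (is_deriveZ b Hc).
rewrite quadE (@derive_val _ _ _ _ _ _ _ Hq) !mxE eqxx/= eq_sym expr1 /GRing.scale/=.
by case: (0 == i); rewrite ?mulr0 ?mulr1 ?addr0//; field.
Qed.

Lemma l2norm_delta (a : R) :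
  l2norm (a *: delta_mx ord0 ord0 : 'rV[R]_D.+1) = `|a|.
Proof.
rewrite /l2norm (bigD1 ord0)//= big1 ?addr0; last first.
  by move=> i /negbTE i0; rewrite !mxE i0 mulr0 expr0n.
by rewrite !mxE/= mulr1 sqrtr_sqr.
Qed.

Lemma coord_le_l2norm x : `|x ord0 ord0| <= l2norm x.
Proof.
rewrite /l2norm -sqrtr_sqr; apply: ler_wsqrtr.
by rewrite (bigD1 ord0)//= lerDl sumr_ge0// => i _; rewrite sqr_ge0.
Qed.

Lemma quad_ge (L b : R) x : 0 < L -> - (b ^+ 2 / (2 * L)) <= quad L b x.
Proof.
move=> L0; rewrite -subr_ge0.
have -> : quad L b x - - (b ^+ 2 / (2 * L)) =
  (L * x ord0 ord0 + b) ^+ 2 / (2 * L).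
  by rewrite /quad; field; rewrite gt_eqF.
by rewrite divr_ge0 ?sqr_ge0// mulr_ge0// ltW.
Qed.

(** The [J] samples are identical, so the sampling variance vanishes and the construction suits
    every [sigma]. *)
Definition quad_cost (J : nat) (L b : R) : local_cost R D.+1 J :=
  fun=> SampleCost (differentiable_quad L b).

Lemma local_fun_quad (J : nat) (L b : R) :
  (0 < J)%N -> local_fun (@quad_cost J L b) = quad L b.
Proof.
move=> J0; apply/funext => x; rewrite /local_fun/= sumr_const card_ord.
by rewrite -[X in _ * X]mulr_natl mulKf// pnatr_eq0 -lt0n.
Qed.

(** With a common curvature [L], [quad] is affine in its tilt, so averaging costs only averages
    tilts and stays within the family. *)
Lemma regular_fun_quad (J W : nat) (Reg : {set 'I_W}) (L : R) (b : 'I_W -> R) :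
  (0 < J)%N -> (0 < #|Reg|)%N ->
  regular_fun Reg (fun w => @quad_cost J L (b w)) =
  quad L (#|Reg|%:R^-1 * \sum_(w in Reg) b w).
Proof.
move=> J0 R0; apply/funext => x; rewrite /regular_fun.
under eq_bigr do rewrite local_fun_quad//.
have Rn0 : #|Reg|%:R != 0 :> R by rewrite pnatr_eq0 -lt0n.
rewrite /quad big_split/= sumr_const -mulr_suml -[_ *+ #|Reg|]mulr_natl.
by field.
Qed.

Lemma l2norm_grad_quad (L b : R) x :
  l2norm (grad (quad L b) x) ^+ 2 = (L * x ord0 ord0 + b) ^+ 2.
Proof. by rewrite grad_quad l2norm_delta real_normK ?num_real. Qed.

(** The curvature terms cancel, so the distance is the same at every point; bounds on tilts thus
    become bounds uniform in [x]. *)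
Lemma l2norm_sub_grad_quad (L b b' : R) x :
  l2norm (grad (quad L b) x - grad (quad L b') x) = `|b - b'|.
Proof.
by rewrite !grad_quad -scalerBl l2norm_delta; congr `|_|; ring.
Qed.

Lemma quad_lipschitz_grad (L b : R) x y : 0 < L ->
  l2norm (grad (quad L b) x - grad (quad L b) y) <= L * l2norm (x - y).
Proof.
move=> L0; rewrite !grad_quad -scalerBl l2norm_delta.
have -> : L * x ord0 ord0 + b - (L * y ord0 ord0 + b) = L * (x - y) ord0 ord0.
  by rewrite !mxE; ring.
by rewrite normrM gtr0_norm// ler_pM2l// coord_le_l2norm.
Qed.

Lemma sample_variance_quad (J : nat) (L b : R) x :
  (0 < J)%N -> sample_variance (@quad_cost J L b) x = 0.
Proof.
move=> J0; rewrite /sample_variance local_fun_quad// big1 ?mulr0// => j _.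
by rewrite l2norm_sub_grad_quad subrr normr0 expr0n.
Qed.

Lemma measurable_borel_coord (i : 'I_D.+1) :
  measurable_fun [set: borel_rV R D.+1] (fun y : borel_rV R D.+1 => y ord0 i).
Proof.
(* It suffices to test preimages of open intervals, which are open by continuity and so belong to
   the generators of [borel_rV]. *)
apply: (measurability _ (RGenOpens.measurableE R)) => _ [_ [a [b ->] <-]].
rewrite setTI; apply: sub_sigma_algebra.
have /continuousP : continuous (fun y : 'rV[R]_D.+1 => y ord0 i).
  exact: coord_continuous.
by apply; exact: interval_open.
Qed.

Lemma measurable_sqr_grad_quad (L b : R) :
  measurable_fun [set: borel_rV R D.+1]
    (fun y : borel_rV R D.+1 => l2norm (grad (quad L b) y) ^+ 2).
Proof.
under eq_fun do rewrite l2norm_grad_quad.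
apply: measurable_funX; apply: measurable_funD => //.
by apply: measurable_funM => //; exact: measurable_borel_coord.
Qed.

End Quad.

(** * Two objectives faced with iterates of the same law *)

Section TwoWorlds.
Variables (R : realType) (D T : nat) (d : measure_display).
Variables (Omega : measurableType d) (P : probability Omega R).

(** [X] and [Y] cannot be compared at a given [omega], only their laws agree. Both expectations are
    therefore moved to the common law on trajectories, where a pointwise inequality suffices. *)
Lemma mean_sqr_grad_quad_ge (X Y : {RV P >-> T.-tuple (borel_rV R D.+1)})
    (L b b' : R) (t : 'I_T) :
  (forall B, measurable B -> distribution P X B = distribution P Y B) ->
  (((b - b') ^+ 2 / 2)%:E <=
    'E_P[fun omega => (l2norm (grad (quad L b) (tnth (X omega) t)) ^+ 2)%R] +
    'E_P[fun omega => (l2norm (grad (quad L b') (tnth (Y omega) t)) ^+ 2)%R])%E.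
Proof.
move=> XY; rewrite unlock.
pose g (a : R) (u : T.-tuple (borel_rV R D.+1)) :=
  (l2norm (grad (quad L a) (tnth u t)) ^+ 2)%:E.
have mg a : measurable_fun setT (g a).
  apply/measurable_EFinP.
  apply: (measurableT_comp (measurable_sqr_grad_quad L a)).
  exact: measurable_tnth.
have g0 a u : (0 <= g a u)%E by rewrite lee_fin sqr_ge0.
rewrite -[X in (_ <= X + _)%E](ge0_integral_distribution X (mg b) (g0 b)).
rewrite -[X in (_ <= _ + X)%E](ge0_integral_distribution Y (mg b') (g0 b')).
rewrite -(eq_measure_integral (distribution P Y) (m1 := distribution P X));
  last by move=> A mA _; exact: XY.
rewrite -ge0_integralD//.
(* The constant is its own integral against a probability law. *)
rewrite -[leLHS]mule1 -(probability_setT (distribution P X)) -integral_cst//.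
apply: ge0_le_integral => //.
- by move=> u _; rewrite lee_fin divr_ge0 ?sqr_ge0.
- by apply: emeasurable_funD.
move=> u _; rewrite -EFinD lee_fin !l2norm_grad_quad; set z := L * _.
rewrite -subr_ge0.
(* With [u = z + b] and [v = z + b'], this is [u^2 + v^2 - (u - v)^2 / 2 = (u + v)^2 / 2]. *)
have -> : (z + b) ^+ 2 + (z + b') ^+ 2 - (b - b') ^+ 2 / 2 =
    (2 * z + b + b') ^+ 2 / 2 by field.
by rewrite divr_ge0 ?sqr_ge0.
Qed.

End TwoWorlds.

(** * Choosing and exchanging groups of workers; halving a sum *)

Lemma exists_subset_card (I : finType) (B : {set I}) (k : nat) :
  (k <= #|B|)%N -> exists2 S : {set I}, S \subset B & #|S| = k.
Proof.
move=> kB; have : (0 < #|[set S : {set I} | S \subset B & #|S| == k]%SET|)%N.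
  by rewrite cards_draws bin_gt0.
by case/card_gt0P => S; rewrite inE => /andP[SB /eqP Sk]; exists S.
Qed.

(** The indicator tuples of [S] and [S'] contain equally many [true] and equally many [false], hence
    are rearrangements of each other. *)
Lemma exists_perm_mem (n : nat) (S S' : {set 'I_n}) : #|S| = #|S'| ->
  exists s : 'S_n, forall w, (w \in S) = (s w \in S').
Proof.
move=> SS'.
have cnt (b : bool) (U : {set 'I_n}) :
    count_mem b [tuple w \in U | w < n] = #|[set w | (w \in U) == b]%SET|.
  rewrite count_map val_ord_tuple -sum1_count big_enum_cond/= -sum1_card.
  by apply: eq_bigl => w; rewrite inE.
have : perm_eq [tuple w \in S | w < n] [tuple w \in S' | w < n].
  have SE (U : {set 'I_n}) : [set w | (w \in U) == true]%SET = U.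
    by apply/setP => w; rewrite inE eqb_id.
  have CE (U : {set 'I_n}) : [set w | (w \in U) == false]%SET = ~: U.
    by apply/setP => w; rewrite !inE eqbF_neg.
  apply/allP => -[] _; rewrite /= !cnt ?SE ?CE ?SS'//.
  by rewrite -(eqn_add2l #|S|) cardsC SS' cardsC.
case/tuple_permP => s E; exists s => w.
have := congr1 (fun u => nth false u w) E.
by rewrite -!tnth_nth !tnth_mktuple.
Qed.

(** Extended reals are used because the mean squared gradients may be infinite. *)
Lemma ge_half_of_add (R : realFieldType) (k : R) (a b : \bar R) :
  (k%:E <= a + b)%E -> ((k / 2)%:E <= a)%E \/ ((k / 2)%:E <= b)%E.
Proof.
move=> kab; case: (leP (k / 2)%:E a) => [|ak]; first by left.
right; rewrite leNgt; apply/negP => bk; move: kab; apply/negP; rewrite -ltNge.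
by rewrite [k]splitr EFinD; apply: lteD.
Qed.

(** * The hard instances and their admissibility *)

Section HardInstance.
Variables (R : realType) (D J W : nat) (L mu : R) (Reg : {set 'I_W}).
Hypotheses (J0 : (0 < J)%N) (L0 : 0 < L) (mu0 : 0 <= mu).
Hypothesis (Reg0 : (0 < #|Reg|)%N).
Implicit Type S : {set 'I_W}.

Definition tilt S w : R := if w \in S then mu else 0.

Definition mean_tilt S : R := #|Reg|%:R^-1 * \sum_(w in Reg) tilt S w.

Definition tilted_costs S : 'I_W -> local_cost R D.+1 J :=
  fun w => @quad_cost R D J L (tilt S w).

Lemma regular_fun_tilted S :
  regular_fun Reg (tilted_costs S) = quad L (mean_tilt S).
Proof. exact: regular_fun_quad. Qed.

Lemma tilt_itv S w : 0 <= tilt S w <= mu.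
Proof. by rewrite /tilt; case: ifP; rewrite ?lexx ?mu0. Qed.

Lemma mean_tilt_itv S : 0 <= mean_tilt S <= mu.
Proof.
have r0 : 0 < #|Reg|%:R :> R by rewrite ltr0n.
apply/andP; split.
  rewrite mulr_ge0 ?invr_ge0 ?ler0n//.
  by apply: sumr_ge0 => w _; case/andP: (tilt_itv S w).
rewrite /mean_tilt.
rewrite mulrC ler_pdivrMr// mulr_natr -sumr_const.
by apply: ler_sum => w _; case/andP: (tilt_itv S w).
Qed.

Lemma mean_tilt_disjoint S : S \subset ~: Reg -> mean_tilt S = 0.
Proof.
move=> /fintype.subsetP SR; rewrite /mean_tilt big1 ?mulr0// => w wR.
by rewrite /tilt; case: ifP => // /SR; rewrite inE wR.
Qed.

Lemma mean_tilt_sub S : S \subset Reg ->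
  mean_tilt S = #|S|%:R / #|Reg|%:R * mu.
Proof.
move=> SR; rewrite /mean_tilt /tilt -big_mkcondr/=.
rewrite (eq_bigl (mem S)) => [|w]; last first.
  by rewrite andb_idl// => /(fintype.subsetP SR).
by rewrite sumr_const -[mu *+ _]mulr_natl mulrCA mulrA.
Qed.

(** Every tilt and the mean tilt lie in [[0, mu]]. As [w] is arbitrary, this serves both the bound
    [xi] on regular workers and the bound [A] on poisoned ones. *)
Lemma tilted_dissimilarity S w y :
  l2norm (grad (local_fun (tilted_costs S w)) y -
          grad (regular_fun Reg (tilted_costs S)) y) <= mu.
Proof.
rewrite regular_fun_tilted local_fun_quad// l2norm_sub_grad_quad.
have /andP[? ?] := tilt_itv S w; have /andP[? ?] := mean_tilt_itv S.
by rewrite ler_norml; apply/andP; split; lra.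
Qed.

Lemma tilted_admissible S (xi sigma A : R) : mu <= xi -> mu <= A ->
  let f := regular_fun Reg (tilted_costs S) in
  [/\ exists fstar : R, forall y, fstar <= f y,
      forall y z, l2norm (grad f y - grad f z) <= L * l2norm (y - z),
      forall w, w \in Reg ->
        forall y,
          l2norm (grad (local_fun (tilted_costs S w)) y - grad f y) <= xi,
      forall w y, sample_variance (tilted_costs S w) y <= sigma ^+ 2 &
      forall w, w \notin Reg ->
        forall y,
          l2norm (grad (local_fun (tilted_costs S w)) y - grad f y) <= A].
Proof.
move=> muxi muA f; split=> [|y z|w _ y|w y|w _ y].
- exists (- (mean_tilt S ^+ 2 / (2 * L))) => y.
  by rewrite /f regular_fun_tilted quad_ge.
- by rewrite /f regular_fun_tilted quad_lipschitz_grad.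
- exact: le_trans (tilted_dissimilarity S w y) muxi.
- by rewrite sample_variance_quad// sqr_ge0.
- exact: le_trans (tilted_dissimilarity S w y) muA.
Qed.

End HardInstance.

(** The right side is the gap between the two mean tilts in units of [mu]. If [r <= W - r] it equals
    [1]; otherwise it is [(W - r) / r], at least [(W - r) / W]. *)
Lemma poisoned_fraction_le (R : realFieldType) (r W : nat) :
  (0 < r)%N -> (r <= W)%N ->
  1 - r%:R / W%:R <= (minn r (W - r))%:R / r%:R :> R.
Proof.
move=> r0 rW; have W0 : (0 < W)%N by exact: leq_trans rW.
have r0' : 0 < r%:R :> R by rewrite ltr0n.
have W0' : 0 < W%:R :> R by rewrite ltr0n.
have rW' : r%:R <= W%:R :> R by rewrite ler_nat.
case: (leqP r (W - r)) => _.
  by rewrite divff ?gt_eqF// lerBlDr lerDl divr_ge0// ltW.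
rewrite natrB//; have -> : 1 - r%:R / W%:R = (W%:R - r%:R) / W%:R :> R.
  by rewrite mulrBl divff ?gt_eqF.
by rewrite ler_wpM2l ?subr_ge0// lef_pV2.
Qed.

(** * The lower bound for identity-invariant algorithms *)

Theorem theorem9 (R : realType) :
  exists2 c0 : R, 0 < c0 &
  forall (D W nreg J T : nat) (L xi sigma A : R),
    (0 < D)%N -> (0 < nreg)%N -> (nreg <= W)%N -> (0 < J)%N -> (0 < T)%N ->
    0 < L -> 0 <= xi -> 0 <= sigma -> 0 <= A ->
  forall (d : measure_display) (Omega : measurableType d)
    (P : probability Omega R) (x : algorithm D J W T P),
    identity_invariant nreg x ->
  forall Reg : {set 'I_W}, #|Reg| = nreg ->
  exists c : 'I_W -> local_cost R D J,
    let f := regular_fun Reg c in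
    let delta := 1 - nreg%:R / W%:R in
    [/\ exists fstar : R, forall y, fstar <= f y,
        forall y z, l2norm (grad f y - grad f z) <= L * l2norm (y - z),
        forall w, w \in Reg ->
          forall y, l2norm (grad (local_fun (c w)) y - grad f y) <= xi,
        forall w y, sample_variance (c w) y <= sigma ^+ 2 &
        forall w, w \notin Reg ->
          forall y, l2norm (grad (local_fun (c w)) y - grad f y) <= A]
    /\
    ((c0 * delta ^+ 2 * Num.min (A ^+ 2) (xi ^+ 2))%R%:E <=
     (T%:R^-1)%R%:E *
       \sum_(t < T)
         'E_P[fun omega =>
                (l2norm (grad f (tnth (x Reg c omega) t)) ^+ 2)%R])%E.
Proof.
(* One factor [1/2] comes from the inequality on two squares, the other from keeping the worse of
   two instances. *)
exists 4^-1 => // D W nreg J T L xi sigma A.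
case: D => // D _ nreg0 nregW J0 T0 L0 xi0 _ A0 d Omega P x inv_x Reg RegE.
pose mu := Num.min A xi; pose k := minn nreg (W - nreg).
have mu0 : 0 <= mu by rewrite le_min A0.
have Reg0 : (0 < #|Reg|)%N by rewrite RegE.
have [S SReg Sk] : exists2 S : {set 'I_W}, S \subset Reg & #|S| = k.
  by apply: exists_subset_card; rewrite RegE geq_minl.
have [S' S'Reg S'k] : exists2 S : {set 'I_W}, S \subset ~: Reg & #|S| = k.
  by apply: exists_subset_card; rewrite cardsCs finset.setCK card_ord RegE geq_minr.
have [s sE] : exists s : 'S_W, forall w, (w \in S) = (s w \in S').
  by apply: exists_perm_mem; rewrite Sk S'k.
pose c := @tilted_costs R D J W L mu.
have cE : c S = fun w => c S' (s w).
  by apply/funext => w; rewrite /c /tilted_costs /tilt sE.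
(* Invariance is used with [Reg] on both sides: the regular workers stay fixed and [s] moves the
   costs. *)
have same_law B : measurable B ->
    distribution P (x Reg (c S')) B = distribution P (x Reg (c S)) B.
  by rewrite cE; exact: inv_x.
pose avg V := (T%:R^-1%:E * \sum_(t < T) 'E_P[fun omega =>
  (l2norm
    (grad (regular_fun Reg (c V)) (tnth (x Reg (c V) omega) t)) ^+ 2)%R])%E.
(* The mean tilt when the tilted workers are regular; it is [0] when they are poisoned. *)
pose b := k%:R / nreg%:R * mu.
have avg_ge : ((b ^+ 2 / 2)%:E <= avg S' + avg S)%E.
  rewrite /avg !regular_fun_tilted//.
  rewrite mean_tilt_disjoint// mean_tilt_sub// Sk RegE.
  rewrite -ge0_muleDr; last 2 first.
    by apply: sume_ge0 => t _; apply: expectation_ge0 => ?; exact: sqr_ge0.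
    by apply: sume_ge0 => t _; apply: expectation_ge0 => ?; exact: sqr_ge0.
  (* Clearing [T^-1] reduces the claim to a bound valid at each iterate separately. *)
  rewrite -big_split/= muleC lee_pdivlMr ?ltr0n//.
  have -> : ((b ^+ 2 / 2)%:E * T%:R%:E = \sum_(t < T) (b ^+ 2 / 2)%:E)%E.
    by rewrite sumEFin sumr_const card_ord -EFinM mulr_natr.
  (* Writing [b ^+ 2] as [(0 - b) ^+ 2] exhibits the two tilts [0] and [b]. *)
  apply: lee_sum => t _; rewrite -[b]opprK sqrrN -[- b]add0r.
  exact: mean_sqr_grad_quad_ge same_law.
set delta := 1 - nreg%:R / W%:R.
have bound : 4^-1 * delta ^+ 2 * Num.min (A ^+ 2) (xi ^+ 2) <= b ^+ 2 / 2 / 2.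
  have delta0 : 0 <= delta.
    rewrite subr_ge0 ler_pdivrMr ?mul1r ?ler_nat// ltr0n.
    exact: leq_trans nregW.
  have -> : Num.min (A ^+ 2) (xi ^+ 2) = mu ^+ 2.
    rewrite /mu; case: (leP A xi) => Axi.
      by rewrite min_l// ler_pXn2r.
    by rewrite min_r// ler_pXn2r// ltW.
  have : (delta * mu) ^+ 2 <= b ^+ 2.
    rewrite ler_pXn2r ?nnegrE ?mulr_ge0 ?divr_ge0//.
    by rewrite ler_wpM2r// poisoned_fraction_le.
  by rewrite exprMn; lra.
have [/(le_trans _) avgV|/(le_trans _) avgV] := ge_half_of_add avg_ge.
- exists (c S'); split; last by apply: avgV; rewrite lee_fin.
  by apply: tilted_admissible; rewrite // ge_min lexx ?orbT.
- exists (c S); split; last by apply: avgV; rewrite lee_fin.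
  by apply: tilted_admissible; rewrite // ge_min lexx ?orbT.
Qed.
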